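(* Let $n_1\le\ldots\le n_d$ and let $A\in\mathbb{C}^{n_1+1}\otimes\ldots\otimes\mathbb{C}^{n_d+1}$ be a tensor. Consider the linear subspace of $\mathbb{C}^{n_1+1}\otimes\ldots\otimes\mathbb{C}^{n_d+1}$ (called the singular space of $A$) given by the following $\sum_{i=1}^d\binom{n_i+1}{2}$ linear equations, divided into $d$ groups: the $\binom{n_i+1}{2}$ equations of the $i$-th group ($i=1,\ldots,d$), written on decomposable tensors $x^1\otimes\ldots\otimes x^d$, are $$A(x^1,\ldots,x^{i-1},e_p,x^{i+1},\ldots,x^d)\,(x^i)_q-A(x^1,\ldots,x^{i-1},e_q,x^{i+1},\ldots,x^d)\,(x^i)_p=0,\qquad 0\le p<q\le n_i.$$ Then the tensor $A$ itself belongs to this linear space.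
   Context: Each $\mathbb{C}^{n_i+1}$ has canonical basis $e_0,\ldots,e_{n_i}$ and is identified with its dual through the standard symmetric bilinear form, so that $A=(A_{i_1\ldots i_d})$ is regarded as the multilinear form $A(x^1,\ldots,x^d)=\sum_{i_1,\ldots,i_d}A_{i_1\ldots i_d}x^1_{i_1}\cdots x^d_{i_d}$, with $(x^i)_q$ the $q$-th coordinate of $x^i\in\mathbb{C}^{n_i+1}$. The left-hand side of each equation is multilinear in $(x^1,\ldots,x^d)$, hence extends uniquely to a linear functional on $\mathbb{C}^{n_1+1}\otimes\ldots\otimes\mathbb{C}^{n_d+1}$; the subspace in question is the common kernel of these functionals. *)

(* Defs.v *)
From HB Require Import structures.
From mathcomp Require Import all_boot all_order all_algebra.
From mathcomp Require Import boolp ring.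

Set Implicit Arguments.
Unset Strict Implicit.
Unset Printing Implicit Defensive.

Import GRing.Theory.
Local Open Scope ring_scope.

(* K^(n_1+1) (x) ... (x) K^(n_d+1) in coordinates: a tensor is the array of   *)
(* its coefficients A_(i_1 ... i_d) in the canonical basis. The factors and   *)
(* the list n are indexed by 'I_d, hence from 0 to d - 1.                     *)
Notation tindex n := {dffun forall i, 'I_(n i).+1}.
Notation tensor K n := {ffun tindex n -> K^o}.
Notation vectors K n := (forall i, 'rV[K]_(n i).+1).

Section SingularSpace.

Variables (K : fieldType) (d : nat) (n : 'I_d -> nat).
Implicit Types (A T : tensor K n) (x : vectors K n) (i : 'I_d) (J : tindex n).
Implicit Types f : vectors K n -> K.

Definition evec (m : nat) (p : 'I_m.+1) : 'rV[K]_m.+1 := delta_mx 0 p.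

(* x^1 (x) ... (x) x^d *)
Definition tprod x : tensor K n := [ffun J : tindex n => \prod_i x i 0 (J i)].

Definition tform A x : K := \sum_(J : tindex n) A J * \prod_i x i 0 (J i).

(* dfwith x v is x with its i-th vector replaced by v : 'rV[K]_(n i).+1. *)
Definition multilinear f :=
  forall x i (a : K) (u v : 'rV[K]_(n i).+1),
    f (dfwith x (a *: u + v)) = a * f (dfwith x u) + f (dfwith x v).

Definition sing_form A i (p q : 'I_(n i).+1) x : K :=
  tform A (dfwith x (evec p)) * x i 0 q - tform A (dfwith x (evec q)) * x i 0 p.

(* The linear functional on tensors induced by a multilinear f; see           *)
(* tensor_ext_tprod and tensor_ext_unique.                                    *)
Definition tensor_ext_fun f T : K^o :=
  \sum_(J : tindex n) T J * f (fun i => evec (J i)).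

Definition tensor_ext f : 'Hom(tensor K n, K^o) := linfun (tensor_ext_fun f).

Definition singular_space A : {vspace tensor K n} :=
  (\bigcap_(i < d) \bigcap_(p < (n i).+1) \bigcap_(q < (n i).+1 | (p < q)%N)
     lker (tensor_ext (sing_form A p q)))%VS.

Fact tensor_ext_fun_is_linear f : linear (tensor_ext_fun f).
Proof.
move=> a T U; rewrite /tensor_ext_fun scaler_sumr -big_split /=.
by apply: eq_bigr => J _; rewrite !ffunE mulrDl -scalerAl.
Qed.

HB.instance Definition _ f :=
  GRing.isLinear.Build K (tensor K n) K^o *:%R (tensor_ext_fun f)
    (tensor_ext_fun_is_linear f).

Lemma tensor_extE f T :
  tensor_ext f T = \sum_(J : tindex n) T J * f (fun i => evec (J i)).
Proof. by rewrite lfunE. Qed.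

Lemma dfwith_id x i : dfwith x (x i) = x.
Proof.
apply: functional_extensionality_dep => j.
by case: (eqVneq i j) => [<-|ij]; rewrite ?dfwith_in // dfwith_out.
Qed.

Lemma multilinear_sum f x i (I : Type) (r : seq I) (c : I -> K)
    (v : I -> 'rV[K]_(n i).+1) : multilinear f ->
  f (dfwith x (\sum_(k <- r) c k *: v k)) =
  \sum_(k <- r) c k * f (dfwith x (v k)).
Proof.
move=> fM; elim: r => [|k r IH]; last by rewrite !big_cons fM IH.
rewrite !big_nil; have := fM x i (-1) 0 0.
by rewrite scaler0 addr0 mulN1r addNr.
Qed.

Lemma multilinear_eq f g : multilinear f -> multilinear g ->
  (forall J, f (fun i => evec (J i)) = g (fun i => evec (J i))) -> f =1 g.
Proof.
move=> fM gM fg.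
suff H k : (k <= d)%N -> forall x,
    (forall i, (k <= i)%N -> exists p, x i = evec p) -> f x = g x.
  by move=> x; apply: (H d) => // i; rewrite leqNgt ltn_ord.
elim: k => [_|k IH kd] x xE.
  have [J JE] : exists J : tindex n, forall i, x i = evec (J i).
    have h i : exists p, x i == evec p by have [p ->] := xE i isT; exists p.
    exists [ffun i => xchoose (h i)] => i; rewrite ffunE.
    exact/eqP/(xchooseP (h i)).
  have -> : x = fun i => evec (J i) by apply: functional_extensionality_dep.
  exact: fg.
pose i := Ordinal kd.
rewrite -(dfwith_id x i) (row_sum_delta (x i)) !multilinear_sum //.
apply: eq_bigr => p _; congr (_ * _); apply: IH => [|j kj]; first exact: ltnW.
case: (eqVneq i j) => [<-|ij]; first by exists p; rewrite dfwith_in.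
rewrite dfwith_out //; apply: xE; rewrite ltn_neqAle kj andbT.
by apply: contra ij => /eqP e; apply/eqP/val_inj.
Qed.

Lemma tform_multilinear A : multilinear (tform A).
Proof.
move=> x i a u v; rewrite /tform mulr_sumr -big_split /=.
apply: eq_bigr => J _.
have E w : \prod_j dfwith x w j 0 (J j)
    = w 0 (J i) * \prod_(j | j != i) x j 0 (J j).
  rewrite (bigD1 i) //= dfwith_in; congr (_ * _).
  by apply: eq_bigr => j ji; rewrite dfwith_out // eq_sym.
by rewrite !E !mxE mulrDl mulrDr -!mulrA [A J * (a * _)]mulrCA.
Qed.

Lemma dfwith_comm x i j (u : 'rV[K]_(n i).+1) (v : 'rV[K]_(n j).+1) :
  i != j -> dfwith (dfwith x u) v = dfwith (dfwith x v) u.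
Proof.
move=> ij; apply: functional_extensionality_dep => k.
case: (eqVneq j k) => [<-|jk]; first by rewrite dfwith_in dfwith_out // dfwith_in.
rewrite dfwith_out //; case: (eqVneq i k) => [<-|ik]; first by rewrite !dfwith_in.
by rewrite !dfwith_out.
Qed.

Lemma dfwith_idem x i (u v : 'rV[K]_(n i).+1) :
  dfwith (dfwith x u) v = dfwith x v.
Proof.
apply: functional_extensionality_dep => k.
by case: (eqVneq i k) => [<-|ik]; rewrite ?dfwith_in // !dfwith_out.
Qed.

Lemma sing_form_multilinear A i (p q : 'I_(n i).+1) :
  multilinear (sing_form A p q).
Proof.
move=> x j a u v; rewrite /sing_form.
case: (eqVneq j i) u v => [->|ji] u v.
  by rewrite !dfwith_idem !dfwith_in !mxE; ring.
rewrite !(dfwith_comm _ _ _ ji) !tform_multilinear !dfwith_out //.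
by ring.
Qed.

Lemma tform_tprod A x : tform A x = \sum_(J : tindex n) A J * tprod x J.
Proof. by apply: eq_bigr => J _; rewrite ffunE. Qed.

Lemma tprod_evec J J' : tprod (fun i => evec (J i)) J' = (J' == J)%:R.
Proof.
rewrite ffunE; case: (eqVneq J' J) => [->|].
  by rewrite big1 // => i _; rewrite !mxE !eqxx.
move=> JJ'; have [i iP] : exists i, J' i != J i.
  apply/existsP; apply: contra_neqT JJ'; rewrite negb_exists => /forallP h.
  by apply/ffunP => i; apply/eqP; have := h i; rewrite negbK.
by rewrite (bigD1 i) //= !mxE (negPf iP) andbF mul0r.
Qed.

Lemma tensor_ext_tprod f x : multilinear f -> tensor_ext f (tprod x) = f x.
Proof.
move=> fM; pose A : tensor K n := [ffun J : tindex n => f (fun i => evec (J i))].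
have E y : tensor_ext f (tprod y) = tform A y.
  by rewrite tensor_extE tform_tprod; apply: eq_bigr => J _; rewrite [A J]ffunE mulrC.
rewrite E; apply: multilinear_eq => // [|J]; first exact: tform_multilinear.
rewrite tform_tprod (bigD1 J) //= tprod_evec eqxx mulr1 ffunE big1 ?addr0 //.
by move=> J' /negPf JJ'; rewrite tprod_evec JJ' mulr0.
Qed.

Lemma tensor_sum_evec T :
  T = \sum_(J : tindex n) (T J : K) *: tprod (fun i => evec (J i)).
Proof.
apply/ffunP => J; rewrite sum_ffunE (bigD1 J) //= !ffunE.
have E J' : \prod_i evec (J' i) 0 (J i) = (J == J')%:R :> K.
  by rewrite -tprod_evec ffunE.
rewrite E eqxx [_ *: _]mulr1 big1 ?addr0 // => J' J'J.
by rewrite !ffunE E eq_sym (negPf J'J) scaler0.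
Qed.

Lemma tensor_ext_unique f (L : 'Hom(tensor K n, K^o)) :
  multilinear f -> (forall x, L (tprod x) = f x) -> L = tensor_ext f.
Proof.
move=> fM Lf; apply/lfunP => T; rewrite [T]tensor_sum_evec !linear_sum.
by apply: eq_bigr => J _; rewrite !linearZ /= Lf tensor_ext_tprod.
Qed.

Lemma mem_singular_space A T :
  (T \in singular_space A) <->
  (forall i (p q : 'I_(n i).+1), (p < q)%N ->
     tensor_ext (sing_form A p q) T = 0).
Proof.
rewrite memvE; split=> [/subv_bigcapP TS i p q pq|TS].
  have /subv_bigcapP/(_ p isT)/subv_bigcapP/(_ q pq) := TS i isT.
  by rewrite -memvE memv_ker => /eqP.
apply/subv_bigcapP => i _; apply/subv_bigcapP => p _; apply/subv_bigcapP => q pq.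
by rewrite -memvE memv_ker TS.
Qed.

End SingularSpace.

(* Main.v *)
(** Evaluated on [A], the equation indexed by [i], [p], [q] reads
    [\sum_(J | J i = q) A_J A_(J with J i := p)
     = \sum_(J | J i = p) A_J A_(J with J i := q)],
    and replacing the [i]-th index exchanges the two sums term by term. *)

Require Import Defs.
From mathcomp Require Import all_boot all_order all_algebra.
From mathcomp Require Import boolp reals.
From mathcomp Require Import complex.

Set Implicit Arguments.
Unset Strict Implicit.
Unset Printing Implicit Defensive.

Local Open Scope ring_scope.

Import GRing.Theory.

(** [dfwith] yields a plain dependent function; tabulating it again gives a finite function, so that
    it can index coefficients and sums. *)
Definition tindex_with (d : nat) (n : 'I_d -> nat) (J : tindex n) (i : 'I_d)
    (p : 'I_(n i).+1) : tindex n :=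
  [ffun j => dfwith J p j].

Lemma tindex_with_in (d : nat) (n : 'I_d -> nat) (J : tindex n) (i : 'I_d)
    (p : 'I_(n i).+1) : tindex_with J p i = p.
Proof. by rewrite ffunE dfwith_in. Qed.

Lemma tindex_withK (d : nat) (n : 'I_d -> nat) (J : tindex n) (i : 'I_d)
    (p : 'I_(n i).+1) : tindex_with (tindex_with J p) (J i) = J.
Proof.
apply/ffunP => j; rewrite ffunE.
case: (eqVneq i j) => [<-|ij]; first by rewrite dfwith_in.
by rewrite dfwith_out // ffunE dfwith_out.
Qed.

Lemma dfwith_evec (K : fieldType) (d : nat) (n : 'I_d -> nat) (J : tindex n)
    (i : 'I_d) (p : 'I_(n i).+1) :
  dfwith (fun j => evec K (J j)) (evec K p)
  = (fun j => evec K (tindex_with J p j)).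
Proof.
apply: functional_extensionality_dep => j; rewrite ffunE.
by case: (eqVneq i j) => [<-|ij]; rewrite ?dfwith_in // !dfwith_out.
Qed.

Lemma tform_evec (K : fieldType) (d : nat) (n : 'I_d -> nat) (A : tensor K n)
    (J : tindex n) : tform A (fun i => evec K (J i)) = A J.
Proof.
rewrite tform_tprod (bigD1 J) //= tprod_evec eqxx mulr1 big1 ?addr0 // => I IJ.
by rewrite tprod_evec (negPf IJ) mulr0.
Qed.

(** On basis vectors [tform A] reads off one coefficient, and a coordinate of a basis vector is a
    Kronecker delta, written here as a boolean multiplicity. *)
Lemma sing_form_evec (K : fieldType) (d : nat) (n : 'I_d -> nat)
    (A : tensor K n) (J : tindex n) (i : 'I_d) (p q : 'I_(n i).+1) :
  sing_form A p q (fun j => evec K (J j))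
  = A (tindex_with J p) *+ (J i == q) - A (tindex_with J q) *+ (J i == p).
Proof.
rewrite /sing_form !dfwith_evec !tform_evec !mxE !eqxx /=.
by rewrite !mulr_natr ![_ == J i]eq_sym.
Qed.

Lemma sum_tindex_with_swap (K : fieldType) (d : nat) (n : 'I_d -> nat)
    (A : tensor K n) (i : 'I_d) (p q : 'I_(n i).+1) :
  \sum_(J : tindex n | J i == q) (A J : K) * A (tindex_with J p)
  = \sum_(J : tindex n | J i == p) (A J : K) * A (tindex_with J q).
Proof.
rewrite (reindex_onto (fun J => tindex_with J q) (fun J => tindex_with J p)).
  (* The round trip [q] then [p] restores [J], so the new summand is the old product with its
     factors exchanged. *)
  apply: eq_big => [J|J /andP[_ /eqP ->]]; last exact: mulrC.
  (* The remaining range condition, that this round trip fixes [J], amounts to [J i = p]. *)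
  rewrite tindex_with_in eqxx /=; apply/eqP/eqP => [<-|<-].
    exact: tindex_with_in.
  exact: tindex_withK.
by move=> J /eqP <-; exact: tindex_withK.
Qed.

Lemma self_mem_singular_space (K : fieldType) (d : nat) (n : 'I_d -> nat)
    (A : tensor K n) : A \in singular_space A.
Proof.
apply/mem_singular_space => i p q _; rewrite tensor_extE.
transitivity (\sum_(J : tindex n | J i == q) (A J : K) * A (tindex_with J p)
            - \sum_(J : tindex n | J i == p) (A J : K) * A (tindex_with J q)).
  (* Padding both restricted sums with zeros lets them be compared term by term with the boolean
     multiplicities. *)
  rewrite [X in _ = X - _]big_mkcond [X in _ = _ - X]big_mkcond -sumrB.
  apply: eq_bigr => J _; rewrite sing_form_evec mulrBr.
  by case: eqP => _; case: eqP => _; rewrite ?mulr1n ?mulr0n ?mulr0.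
by rewrite sum_tindex_with_swap subrr.
Qed.

Theorem proposition5p5 (R : realType) (d : nat) (n : 'I_d -> nat)
    (n_le : forall i j : 'I_d, (i <= j)%N -> (n i <= n j)%N)
    (A : tensor R[i] n) :
  A \in singular_space A.
Proof. exact: self_mem_singular_space. Qed.
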